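(* Let $\delta>0$, $h=h(\delta)>0$, $\tau>0$, and let the Structural Assumptions (A1)–(A8) listed in the context hold. Let $m_{(\mathrm I_\delta)}$ and $m_{(\mathrm{McC}_{\delta\tau})}$ be the optimal objective values of the problems $(\mathrm I_\delta)$ and $(\mathrm{McC}_{\delta\tau})$ defined in the context. Then $$m_{(\mathrm I_\delta)}\ \ge\ m_{(\mathrm{McC}_{\delta\tau})}-\inf\bigl\{\|Tu-Tu_\tau\|_Y:\ (u,w)\in\arg\min(\mathrm I_\delta),\ u_\tau\text{ solves }Au_\tau+f_0(P_\tau u_\tau)(P_\tau w)=f_1\bigr\}.$$
   Context: Setting. $\Omega\subset\mathbb{R}^d$, $d\in\mathbb{N}$, is a bounded Lipschitz domain; $U$ is a Banach space continuously embedded in $L^2(\Omega)$; $A:U\to L^2(\Omega)$ is a linear isomorphism; $T:L^2(\Omega)\to Y$ is a bounded linear observation operator into a Banach space $Y$; $y^\delta\in Y$; $f_0\in L^\infty(\Omega)$, $f_0\ge0$; $f_1\in L^2(\Omega)$. $w_\ell,w_u\in L^\infty(\Omega)$ are given, and $W^{\mathrm{ad}}$ is a nonempty subset of $\{w\in L^\infty(\Omega): w_\ell\le w\le w_u \text{ a.e. in }\Omega\}$. Meshes and projections. $\mathcal{Q}_h=\{Q_h^1,\dots,Q_h^{N_h}\}$ and $\mathcal{Q}_\tau=\{Q_\tau^1,\dots,Q_\tau^{N_\tau}\}$ are finite partitions of $\Omega$ with mesh sizes $h$ and $\tau$. $V_h$ is the discretization set for $w$, defined on $\mathcal{Q}_h$,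 and $W^{\mathrm{ad}}_h=W^{\mathrm{ad}}\cap V_h$. $P_{V_h}$ and $P_{W_h^{\mathrm{ad}}}$ are the $L^2(\Omega)$-metric projections onto $V_h$ and $W^{\mathrm{ad}}_h$. $P_\tau$ is local averaging: $(P_\tau v)|_{Q_\tau^i}=|Q_\tau^i|^{-1}\int_{Q_\tau^i}v\,dx$. State equations: (E) $Au+f_0uw=f_1$; (E$_\tau$) $Au+f_0(P_\tau u)(P_\tau w)=f_1$. Problems. $(\mathrm I_\delta)$: minimize $\|Tu-y^\delta\|_Y$ over $(u,w)$, $u\in U$, subject to $Au+f_0uw=f_1$, $w\in W^{\mathrm{ad}}_h$. $(\mathrm{McC}_{\delta\tau})$: minimize $\|Tu-y^\delta\|_Y$ over $(u,w,z)$, $u\in U$, subject to $Au+f_0z=f_1$, $w\in\mathrm{conv}\,W^{\mathrm{ad}}_h$, $z\in Z^{\mathrm{ad}}_\tau$, and, for all $i\in\{1,\dots,N_\tau\}$, a.e. in $Q_\tau^i$, with $z_i$ the constant value of $z$ on $Q^i_\tau$ and $u_\ell^i,u_u^i,w_\ell^i,w_u^i$ from (A4), (A5): $u^i_\ell P_\tau w+w^i_\ell P_\tau u-u^i_\ell w^i_\ell-z_i\le0$, $\ u^i_uP_\tau w+w^i_uP_\tau u-u^i_uw^i_u-z_i\le0$, $\ z_i-u^i_uP_\tau w-w^i_\ell P_\tau u+u^i_uw^i_\ell\le0$, $\ z_i-u^i_\ell P_\tau w-w^i_uP_\tau u+u^i_\ell w^i_u\le0$. Structural Assumptions. (A1)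 $V_h$ is a closed convex subset of a finite-dimensional ansatz space for $L^2(\Omega)$. (A2) For all $w\in W^{\mathrm{ad}}$, (E) and (E$_\tau$) admit unique solutions in $U$. (A3) There are $u_\ell,u_u\in L^\infty(\Omega)$ such that for all $w\in W^{\mathrm{ad}}$ the solution $u$ of (E) satisfies $u_\ell\le u\le u_u$ a.e. in $\Omega$. (A4) There are $u_\ell^i,u_u^i\in\mathbb{R}$ such that for all $w\in W^{\mathrm{ad}}$ the solution $u$ of (E$_\tau$) satisfies $u_\ell^i\le P_\tau u\le u_u^i$ a.e. in $Q_\tau^i$, $i=1,\dots,N_\tau$. (A5) There are $w_\ell^i,w_u^i\in\mathbb{R}$ such that for all $w\in W^{\mathrm{ad}}_h$, $w_\ell^i\le P_\tau w\le w_u^i$ a.e. in $Q_\tau^i$, $i=1,\dots,N_\tau$. (A6) $P_{V_h}w=P_{W^{\mathrm{ad}}_h}w$ for all $w\in W^{\mathrm{ad}}$. (A7) $Z^{\mathrm{ad}}$ is a closed, convex, bounded subset of $L^\infty(\Omega)$, and $uw\in Z^{\mathrm{ad}}$ whenever $u$ solves (E) for $w\in W^{\mathrm{ad}}_h$. (A8) $Z^{\mathrm{ad}}_\tau$ is a closed, convex, bounded subset of $L^\infty(\Omega)$ consisting of piecewise constant functions on $\mathcal{Q}_\tau$, and $(P_\tau u)(P_\tau w)\in Z^{\mathrm{ad}}_\tau$ whenever $u$ solves (E$_\tau$) for $w\in W^{\mathrm{ad}}_h$. *)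

(* Defs.v *)
From HB Require Import structures.
From mathcomp Require Import all_boot all_order all_algebra.
From mathcomp Require Import all_classical all_reals all_analysis.
From mathcomp Require Import measurable_realfun ess_sup_inf hoelder.
Set Implicit Arguments.
Unset Strict Implicit.
Unset Printing Implicit Defensive.
Import Order.TTheory GRing.Theory Num.Theory.
Import numFieldNormedType.Exports.
Local Open Scope classical_set_scope.
Local Open Scope ring_scope.

Section Lnorm_ae.
Context d (T : measurableType d) (R : realType).
Variables (mu : {measure set T -> \bar R}) (p : \bar R).
Lemma ae_eq_Lnorm (f g : T -> R) : (1 <= p)%E ->
  measurable_fun setT f -> measurable_fun setT g ->
  (\forall x \ae mu, f x = g x) ->
  'N[mu]_p[EFin \o f]%E = 'N[mu]_p[EFin \o g]%E.
Proof.
move=> p1 mf mg fg; rewrite unlock /Lnorm; case: p p1 => [r r1||//].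
- congr (_ `^ _)%E; apply: ge0_ae_eq_integral => //.
  + apply/measurable_EFinP.
    apply: (@measurableT_comp _ _ _ _ _ _ (@powR R ^~ r)) => //.
    exact: measurableT_comp.
  + apply/measurable_EFinP.
    apply: (@measurableT_comp _ _ _ _ _ _ (@powR R ^~ r)) => //.
    exact: measurableT_comp.
  + by move=> x _; rewrite lee_fin powR_ge0.
  + by move=> x _; rewrite lee_fin powR_ge0.
  + by apply: filterS fg => x /= -> _.
- move=> _; case: ifPn => // _; apply: eq_ess_sup.
  by apply: filterS fg => x /= ->.
Qed.
End Lnorm_ae.

(* The library provides L^p as a quotient set; we equip it with its structure of
   normed space, so that closed, bounded and convex subsets and continuous
   linear maps below are the library notions. *)
Section Lspace_normed.
Context d (T : measurableType d) (R : realType).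
Variables (mu : {measure set T -> \bar R}) (p : \bar R) (p1 : (1 <= p)%E).
Local Notation Lp := (LspaceType mu p1).
Local Notation Lf := (LfunType mu p1).
Local Open Scope quotient_scope.

(* A representative of the class f; only its values up to a null set are
   meaningful, so it is always used under an a.e. quantifier or an integral. *)
Definition Lspace_fun (f : Lp) : T -> R := f : {mfun_ mu, T >-> measurableTypeR R}.

Lemma Lspace_funP (f : Lp) : Lspace_fun f \in Lfun mu p.
Proof.
rewrite inE; apply/andP; split; rewrite inE /=; last exact: Lebesgue_finite.
exact: (@measurable_funPT _ _ T (measurableTypeR R) (repr (LebesgueSpace.sort f))).
Qed.

Definition Lspace_repr (f : Lp) : Lf := Lfun_Sub p1 (Lspace_funP f).

Lemma eq_LspaceP (f g : Lp) :
  (\forall x \ae mu, Lspace_fun f x = Lspace_fun g x) -> f = g.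
Proof.
move=> fg.
have efg : LebesgueSpace.sort f = LebesgueSpace.sort g :> {mfun_ mu, T >-> measurableTypeR R}.
  rewrite -[LHS]reprK -[RHS]reprK; apply/eqP; rewrite eqmodE; apply/asboolP.
  by apply: filterS fg => x.
case: f g efg {fg} => [f [[Hf]]] [g [[Hg]]] /= efg.
by subst g; rewrite (Prop_irrelevance Hf Hg).
Qed.

Section classof.
Variable f : Lf.
Let fR : T -> measurableTypeR R := f.
Let mfR : measurable_fun setT fR.
Proof. by move=> mD Y mY; exact: (@measurable_funPT _ _ _ _ f mD Y mY). Qed.
HB.instance Definition _ := isMeasurableFun.Build d _ T (measurableTypeR R) fR mfR.
Let c : {mfun_ mu, T >-> measurableTypeR R} :=
  \pi_({mfun_ mu, T >-> measurableTypeR R}) (fR : {mfun T >-> measurableTypeR R}).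

Let class_ae : \forall x \ae mu, (c : T -> R) x = f x.
Proof.
have : repr c = (fR : {mfun T >-> measurableTypeR R}) %[mod {mfun_ mu, T >-> measurableTypeR R}].
  by rewrite reprK.
move=> /eqP; rewrite eqmodE => /asboolP; apply: filterS => x; exact.
Qed.

Let class_finite : finite_norm mu p (c : T -> R).
Proof.
rewrite /finite_norm (@ae_eq_Lnorm _ _ _ _ _ _ f)//.
- exact: Lfunction_finite.
- exact: (@measurable_funPT _ _ T (measurableTypeR R) (repr c)).
Qed.

HB.instance Definition _ := @isFinLebesgue.Build d T R mu p p1 c class_finite.

Definition Lspace_class : Lp := c.

Lemma Lspace_classE : \forall x \ae mu, Lspace_fun Lspace_class x = f x.
Proof. exact: class_ae. Qed.
End classof.

HB.instance Definition _ := gen_eqMixin Lp.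
HB.instance Definition _ := gen_choiceMixin Lp.

Definition Lspace_add (f g : Lp) := Lspace_class (Lspace_repr f + Lspace_repr g).
Definition Lspace_opp (f : Lp) := Lspace_class (- Lspace_repr f).
Definition Lspace_scale (a : R) (f : Lp) := Lspace_class (a *: Lspace_repr f).
Definition Lspace_zero := Lspace_class (0 : Lf).

Lemma Lspace_add_ae f g : \forall x \ae mu,
  Lspace_fun (Lspace_add f g) x = Lspace_fun f x + Lspace_fun g x.
Proof. exact: Lspace_classE. Qed.
Lemma Lspace_opp_ae f : \forall x \ae mu,
  Lspace_fun (Lspace_opp f) x = - Lspace_fun f x.
Proof. exact: Lspace_classE. Qed.
Lemma Lspace_scale_ae a f : \forall x \ae mu,
  Lspace_fun (Lspace_scale a f) x = a * Lspace_fun f x.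
Proof. exact: Lspace_classE. Qed.
Lemma Lspace_zero_ae : \forall x \ae mu, Lspace_fun Lspace_zero x = 0.
Proof. exact: Lspace_classE. Qed.


Local Notation "f +' g" := (Lspace_add f g) (at level 50).

Let addA : associative Lspace_add.
Proof.
move=> f g h; apply: eq_LspaceP.
apply: filterS2 (filterI (Lspace_add_ae f (g +' h)) (Lspace_add_ae g h))
  (filterI (Lspace_add_ae (f +' g) h) (Lspace_add_ae f g)).
by move=> x [-> ->] [-> ->]; rewrite addrA.
Qed.

Let addC : commutative Lspace_add.
Proof.
move=> f g; apply: eq_LspaceP.
apply: filterS2 (Lspace_add_ae f g) (Lspace_add_ae g f).
by move=> x -> ->; rewrite addrC.
Qed.

Let add0 : left_id Lspace_zero Lspace_add.
Proof.
move=> f; apply: eq_LspaceP.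
apply: filterS2 (Lspace_add_ae Lspace_zero f) Lspace_zero_ae.
by move=> x -> ->; rewrite add0r.
Qed.

Let addN : left_inverse Lspace_zero Lspace_opp Lspace_add.
Proof.
move=> f; apply: eq_LspaceP.
apply: filterS3 (Lspace_add_ae (Lspace_opp f) f) (Lspace_opp_ae f) Lspace_zero_ae.
by move=> x -> -> ->; rewrite addNr.
Qed.

HB.instance Definition _ := GRing.isZmodule.Build Lp addA addC add0 addN.

Let scaleA a b f : Lspace_scale a (Lspace_scale b f) = Lspace_scale (a * b) f.
Proof.
apply: eq_LspaceP.
apply: filterS3 (Lspace_scale_ae a (Lspace_scale b f)) (Lspace_scale_ae b f)
  (Lspace_scale_ae (a * b) f).
by move=> x -> -> ->; rewrite mulrA.
Qed.

Let scale1 : left_id 1 Lspace_scale.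
Proof.
move=> f; apply: eq_LspaceP.
by apply: filterS (Lspace_scale_ae 1 f) => x ->; rewrite mul1r.
Qed.

Let scaleDr : right_distributive Lspace_scale +%R.
Proof.
move=> a f g; apply: eq_LspaceP.
apply: filterS2
  (filterI (Lspace_scale_ae a (f + g)) (Lspace_add_ae f g))
  (filterI (Lspace_add_ae (Lspace_scale a f) (Lspace_scale a g))
    (filterI (Lspace_scale_ae a f) (Lspace_scale_ae a g))).
by move=> x [-> ->] [-> [-> ->]]; rewrite mulrDr.
Qed.

Let scaleDl f : {morph Lspace_scale^~ f : a b / a + b}.
Proof.
move=> a b; apply: eq_LspaceP.
apply: filterS2
  (filterI (Lspace_scale_ae (a + b) f)
    (Lspace_add_ae (Lspace_scale a f) (Lspace_scale b f)))
  (filterI (Lspace_scale_ae a f) (Lspace_scale_ae b f)).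
by move=> x [-> ->] [-> ->]; rewrite mulrDl.
Qed.

HB.instance Definition _ :=
  GRing.Zmodule_isLmodule.Build R Lp scaleA scale1 scaleDr scaleDl.

Definition Lspace_norm (f : Lp) : R := fine 'N[mu]_p[EFin \o Lspace_fun f]%E.

Let norm_class (f : Lf) :
  Lspace_norm (Lspace_class f) = fine 'N[mu]_p[EFin \o f]%E.
Proof.
congr fine; apply: ae_eq_Lnorm => //; last exact: Lspace_classE.
exact: (measurable_funPT (Lspace_repr (Lspace_class f))).
Qed.

Let normD (f g : Lp) : Lspace_norm (f + g) <= Lspace_norm f + Lspace_norm g.
Proof. by rewrite norm_class; exact: ler_LnormD. Qed.

Let normZ a (f : Lp) : Lspace_norm (a *: f) = `|a| * Lspace_norm f.
Proof.
rewrite norm_class.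
have -> : fine 'N[mu]_p[EFin \o (a *: Lspace_repr f : Lf)]%E =
          fine (`|a|%:E * 'N[mu]_p[EFin \o Lspace_repr f])%E.
  by rewrite -LnormZ.
by rewrite fineM// -finite_norm_fine.
Qed.

Let norm_eq0 (f : Lp) : Lspace_norm f = 0 -> f = 0.
Proof.
move=> f0; have := @fine_Lnormr_eq0 _ _ _ mu p p1 (Lspace_repr f) f0.
move=> h; apply: eq_LspaceP; apply: filterS2 h Lspace_zero_ae => x.
by move=> fx0 zx0; exact: etrans (fx0 Logic.I) (esym zx0).
Qed.

HB.instance Definition _ :=
  @Lmodule_isNormed.Build R Lp Lspace_norm normD normZ norm_eq0.

Lemma Lspace_normE (f : Lp) : `|f| = fine 'N[mu]_p[EFin \o Lspace_fun f]%E.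
Proof. by []. Qed.
End Lspace_normed.

Coercion Lspace_fun : LebesgueSpace.type >-> Funclass.

Definition borelRV (R : realType) (n : nat) :=
  g_sigma_algebraType (@open 'rV[R]_n).

(* Lebesgue measure on the Borel sets of R^n, by slicing along the first
   coordinate (lambda^(n+1) is the product of lambda and lambda^n). *)
Fixpoint lebesgueRV (R : realType) (n : nat) : set (borelRV R n) -> \bar R :=
  if n is m.+1 then fun A => (\int[@lebesgue_measure R]_x
    lebesgueRV [set t : borelRV R m | A (row_mx (x%:M : 'rV_1) t)])%E
  else dirac ((0 : 'rV[R]_0) : borelRV R 0).

Section lebesgueRV_measure.
Variable R : realType.
Local Notation rV n := 'rV[R]_n.

Lemma mx_ballE n (x : rV n) e (y : rV n) :
  ball x e y <-> 0 < e /\ forall j, ball (x 0 j) e (y 0 j).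
Proof.
split=> [[e0 h]|[e0 h]]; first by split.
by split=> // i j; rewrite !ord1.
Qed.

Lemma open_bigcup_ball n (O : set (rV n)) : open O ->
  O = \bigcup_(q in [set q : 'rV[rat]_n * nat |
        ball (map_mx ratr q.1 : rV n) (q.2.+1%:R^-1) `<=` O])
      ball (map_mx ratr q.1 : rV n) (q.2.+1%:R^-1).
Proof.
move=> oO; apply/seteqP; split=> [x Ox|x [q qO]]; last exact: qO.
have /nbhs_ballP[e /= e0 xeO] : nbhs x O by exact: open_nbhs_nbhs.
have [k _ ke] : exists2 k, True & k.+1%:R^-1 < e / 2.
  have e20 : 0 < e / 2 by rewrite divr_gt0.
  have [k _ /(_ k (leqnn k))] := near_infty_natSinv_lt (PosNum e20).
  by exists k.
pose r : R := k.+1%:R^-1; have r0 : 0 < r by rewrite invr_gt0.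
have /choice[q qP] : forall j, exists q : rat, ball (x 0 j) r (ratr q).
  move=> j; have : x 0 j - r < x 0 j + r by rewrite ltrD2l gtrN.
  move=> /rat_in_itvoo[q]; rewrite in_itv /= => qx; exists q.
  by rewrite /ball /= ltr_distlC.
have bxq : ball (map_mx ratr (\row_j q j) : rV n) r x.
  by apply/mx_ballE; split=> // j; rewrite !mxE; apply: ball_sym.
exists (\row_j q j, k) => //= y qy; apply: xeO.
apply: (@le_ball _ _ _ (r + r)); first by rewrite (splitr e) lerD// ltW.
by apply: ball_triangle qy; exact: ball_sym.
Qed.

Lemma measurable_rV_ball n (x : rV n) e :
  measurable (ball x e : set (borelRV R n)).
Proof.
have [e0|e0] := ltP 0 e.
  by apply: sub_sigma_algebra; exact: ball_open.
rewrite (_ : ball x e = set0) ?measurable0//.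
by apply/seteqP; split=> // y /mx_ballE[]; rewrite ltNge e0.
Qed.

Lemma measurable_fun_rV d (T : measurableType d) n (f : T -> borelRV R n) :
  (forall x e, measurable (f @^-1` (ball (x : rV n) e))) ->
  measurable_fun setT f.
Proof.
move=> mf; apply: (@measurability _ _ _ _ setT f (@open (rV n))) => //.
move=> _ [B oB <-]; rewrite setTI (open_bigcup_ball oB) preimage_bigcup.
rewrite bigcup_mkcond; apply: countable_bigcupT_measurable => // q.
by case: ifPn => // _; exact: mf.
Qed.

Definition cons_rV n (p : measurableTypeR R * borelRV R n) : borelRV R n.+1 :=
  row_mx (p.1%:M : 'rV_1) (p.2 : rV n).

Lemma cons_rV_ball n (c : 'rV[R]_(1 + n)) e :
  @cons_rV n @^-1` (ball (c : rV n.+1) e) =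
  ball (c 0 (lshift n 0)) e `*` ball (rsubmx c : rV n) e.
Proof.
apply/seteqP; split=> [[x t] /mx_ballE[e0 h]|[x t] [/= xc /mx_ballE[e0 tc]]].
- split=> /=; first by have := h (@lshift 1 n 0); rewrite /cons_rV (@row_mxEl _ 1 1 n) mxE eqxx.
  by apply/mx_ballE; split=> // j; have := h (@rshift 1 n j); rewrite /cons_rV (@row_mxEr _ 1 1 n) mxE.
- apply/mx_ballE; split=> // j; rewrite /cons_rV /=.
  have [i ->|i ->] := @split_ordP 1 n j.
    by rewrite (@row_mxEl _ 1 1 n) mxE ord1 eqxx.
  by rewrite (@row_mxEr _ 1 1 n); have := tc i; rewrite mxE.
Qed.

Lemma measurable_cons_rV n : measurable_fun setT (@cons_rV n).
Proof.
apply: measurable_fun_rV => x e; rewrite cons_rV_ball.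
by apply: measurableX; [exact: measurable_ball|exact: measurable_rV_ball].
Qed.

Section step.
Variables (n : nat) (m : {sigma_finite_measure set (borelRV R n) -> \bar R}).
Let prodm := (@lebesgue_measure R \x m)%E.
Definition pushRV : set (borelRV R n.+1) -> \bar R := pushforward prodm (@cons_rV n).

Let pushRV0 : pushRV set0 = 0%E.
Proof. by rewrite /pushRV /pushforward preimage_set0; exact: (@measure0 _ _ _ (@lebesgue_measure R \x m)%E). Qed.

Let pushRV_ge0 A : (0 <= pushRV A)%E.
Proof. exact: integral_ge0. Qed.

Let pushRV_sigma_additive : semi_sigma_additive pushRV.
Proof.
have mc A : measurable A -> measurable (@cons_rV n @^-1` A).
  by rewrite -[X in _ -> measurable X]setTI; exact: measurable_cons_rV.
move=> F mF tF mUF; rewrite /pushRV /pushforward preimage_bigcup.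
apply: measure_semi_sigma_additive.
- by move=> k; exact: mc.
- apply/trivIsetP => /= i j _ _ ij; rewrite -preimage_setI.
  by move/trivIsetP : tF => /(_ _ _ _ _ ij) ->//; rewrite preimage_set0.
- by rewrite -preimage_bigcup; exact: mc.
Qed.

HB.instance Definition _ := isMeasure.Build _ _ _ pushRV
  pushRV0 pushRV_ge0 pushRV_sigma_additive.

Hypothesis m_ball : forall e, (m (ball (0%R : rV n) e) < +oo)%E.

Lemma pushRV_ball e : (pushRV (ball (0%R : rV n.+1) e) < +oo)%E.
Proof.
rewrite /pushRV /pushforward cons_rV_ball /prodm.
rewrite (@product_measure1E _ _ _ _ R (@lebesgue_measure R) m)//; last 2 first.
- exact: measurable_ball.
- exact: measurable_rV_ball.
have m0 : (m (ball (rsubmx (0%R : 'rV[R]_(1 + n)) : rV n) e) < +oo)%E.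
  by rewrite linear0; exact: m_ball.
apply: lte_mul_pinfty => //.
suff lb (c : R) : (@lebesgue_measure R (ball c e) \is a fin_num)%E by exact: lb.
have [e0|e0] := leP 0 e.
  by rewrite (@lebesgue_measure_ball R c e e0).
rewrite (_ : ball c e = set0) ?measure0//.
by apply/seteqP; split=> // y; rewrite /ball /= ltNge (le_trans (ltW e0)).
Qed.

Let pushRV_sfinite : sigma_finite setT pushRV.
Proof.
exists (fun k => ball (0%R : rV n.+1) k.+1%:R).
  apply/seteqP; split=> // x _.
  have [k kx] : exists k, `|x : rV n.+1| < k.+1%:R.
    exists (Num.truncn `|x : rV n.+1|); exact: truncnS_gt.
  by exists k => //; rewrite -ball_normE /= sub0r normrN.
by move=> k; split; [exact: measurable_rV_ball|exact: pushRV_ball].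
Qed.

HB.instance Definition _ := @Measure_isSigmaFinite.Build _ _ _ pushRV pushRV_sfinite.
Definition pushRV_sfm : {sigma_finite_measure set (borelRV R n.+1) -> \bar R} := pushRV.
End step.

Lemma lebesgueRV_sfm n : {m : {sigma_finite_measure set (borelRV R n) -> \bar R} |
  (m : set _ -> \bar R) = @lebesgueRV R n /\
  forall e, (m (ball (0%R : rV n) e) < +oo)%E}.
Proof.
elim: n => [|n [m [mE mb]]].
  exists (dirac (0 : borelRV R 0) : {sigma_finite_measure set _ -> \bar R}).
  by split=> // e; rewrite /= /dirac ltry.
exists (pushRV_sfm mb); split; last exact: pushRV_ball.
apply/funext => A; rewrite /= -mE; apply: eq_integral => x _ /=; congr (m _).
by apply/seteqP; split=> t; rewrite /xsection /= inE.
Qed.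

Section instance.
Variable n : nat.
Local Notation leb := (@lebesgueRV R n).
Let leb0 : leb set0 = 0%E.
Proof. by have [m [<- _]] := lebesgueRV_sfm n; exact: measure0. Qed.
Let leb_ge0 A : (0 <= leb A)%E.
Proof. by have [m [<- _]] := lebesgueRV_sfm n; exact: measure_ge0. Qed.
Let leb_sigma_additive : semi_sigma_additive leb.
Proof. by have [m [<- _]] := lebesgueRV_sfm n; exact: measure_semi_sigma_additive. Qed.
HB.instance Definition _ := isMeasure.Build _ _ _ leb leb0 leb_ge0 leb_sigma_additive.
Let leb_sfinite : sigma_finite setT leb.
Proof. by have [m [<- _]] := lebesgueRV_sfm n; exact: sigma_finiteT. Qed.
HB.instance Definition _ := @Measure_isSigmaFinite.Build _ _ _ leb leb_sfinite.

Lemma lebesgueRV_ball e : (leb (ball (0%R : rV n) e) < +oo)%E.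
Proof. by have [m [<- mb]] := lebesgueRV_sfm n. Qed.
End instance.
End lebesgueRV_measure.

Section euclidean.
Variables (R : realType) (d : nat).
Definition dotRV (x y : 'rV[R]_d) : R := (x *m y^T) 0 0.
Definition enorm (x : 'rV[R]_d) : R := Num.sqrt (dotRV x x).
End euclidean.

(* Near each boundary point p, the domain is the region above the graph of a
   Lipschitz function g over the hyperplane orthogonal to the unit vector v;
   x - <x, v> v is the orthogonal projection of x on that hyperplane. *)
Record lipschitz_domain (R : realType) (d : nat) := LipschitzDomain {
  dom_set :> set 'rV[R]_d ;
  dom_open : open dom_set ;
  dom_connected : connected dom_set ;
  dom_nonempty : dom_set !=set0 ;
  dom_bounded : bounded_set dom_set ;
  dom_lipschitz : forall p, (closure dom_set `\` dom_set) p ->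
    exists (v : 'rV[R]_d) (g : 'rV[R]_d -> R),
      [/\ enorm v = 1, lipschitz g &
          \forall x \near p,
            dom_set x <-> g (x - dotRV x v *: v) < dotRV x v] }.

Section domain.
Variables (R : realType) (d : nat) (Omega : lipschitz_domain R d).

Lemma measurable_dom : measurable (Omega : set (borelRV R d)).
Proof. by apply: sub_sigma_algebra; exact: dom_open. Qed.

(* A measure on the whole space that ignores the complement of Omega: a
   property holds a.e. for lebOn iff it holds a.e. in Omega. *)
Definition lebOn : {measure set (borelRV R d) -> \bar R} :=
  mrestr (@lebesgueRV R d) measurable_dom.

Lemma lebOn_fin : lebOn [set: borelRV R d] \is a fin_num.
Proof.
rewrite ge0_fin_numE; last exact: measure_ge0.
have [M [_ /(_ (M + 1))]] := dom_bounded Omega.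
rewrite ltrDl ltr01 => /(_ isT) Mb.
rewrite /lebOn /= /mrestr setTI.
apply: le_lt_trans (@lebesgueRV_ball R d (M + 2)).
apply: le_measure; rewrite ?inE; [exact: measurable_dom| |].
  exact: measurable_rV_ball.
move=> x /Mb xM; rewrite -ball_normE /= sub0r normrN.
by apply: le_lt_trans xM _; rewrite ltrD2l ltr1n.
Qed.

#[global] Instance lebOn_filter : Filter (almost_everywhere lebOn).
Proof. exact: ae_filter_ringOfSetsType. Qed.

#[global] Instance lebOn_nbhs_filter : Filter (nbhs (almost_everywhere lebOn)).
Proof. exact: lebOn_filter. Qed.

Local Notation Linf := (LspaceType lebOn (leey 1)).
Local Notation L2 := (LspaceType lebOn (lee1n 2)).

Lemma Linf_Lfun2 (f : Linf) : (f : _ -> R) \in Lfun lebOn 2%:R%:E.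
Proof.
apply: (Lfun_subset (lee1n 2) (leey 1) lebOn_fin (leey _)).
exact: Lspace_funP.
Qed.

(* the inclusion of L^oo(Omega) in L^2(Omega) *)
Definition LinfL2 (f : Linf) : L2 := Lspace_class (Lfun_Sub (lee1n 2) (Linf_Lfun2 f)).

(* the function f belongs to the set S of classes *)
Definition mem_ae (S : set Linf) (f : 'rV[R]_d -> R) :=
  exists2 z : Linf, S z & \forall x \ae lebOn, z x = f x.

End domain.

Notation L2 Omega := (LspaceType (lebOn Omega) (lee1n 2)).
Notation Linf Omega := (LspaceType (lebOn Omega) (leey 1)).

(* The cells need positive measure for the averages below to make sense. *)
Record mesh (R : realType) (d : nat) (Omega : lipschitz_domain R d) := Mesh {
  ncells : nat ;
  cell : 'I_ncells -> set 'rV[R]_d ;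
  cell_measurable : forall i, measurable (cell i : set (borelRV R d)) ;
  cell_partition : partition setT cell Omega ;
  cell_pos : forall i, (0 < lebOn Omega (cell i))%E }.

Section mesh_theory.
Variables (R : realType) (d : nat) (Omega : lipschitz_domain R d).
Variable Q : mesh Omega.

Definition mesh_size : R :=
  sup [set r | exists i x y, [/\ cell (m := Q) i x, cell i y & r = enorm (x - y)]].

(* P_tau, as a step function *)
Definition local_average (v : 'rV[R]_d -> R) : 'rV[R]_d -> R := fun x =>
  \sum_(i < ncells Q) (fine (lebOn Omega (cell i)))^-1 *
    (\int[lebOn Omega]_(t in cell i) v t)%R * \1_(cell i) x.

Definition cell_values (z : 'rV[R]_d -> R) (c : 'I_(ncells Q) -> R) :=
  forall i, \forall x \ae lebOn Omega, cell i x -> z x = c i.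

Definition piecewise_constant (z : 'rV[R]_d -> R) := exists c, cell_values z c.

End mesh_theory.

Section notions.
Variable R : realType.

Definition continuous_embedding (V W : normedModType R) (f : {linear V -> W}) :=
  injective f /\ continuous f.

Definition linear_isomorphism (V W : normedModType R) (f : {linear V -> W}) :=
  exists g : W -> V, [/\ cancel f g, cancel g f, continuous f & continuous g].

Definition within_fin_dim (V : lmodType R) (S : set V) :=
  exists (n : nat) (e : 'I_n -> V),
    forall v, S v -> exists a : 'I_n -> R, v = \sum_(i < n) a i *: e i.

Definition conv_hull (V : lmodType R) (S : set V) : set V :=
  smallest (@convex_set R V) S.

(* the set of points of S nearest to x; the metric projection of x on S is
   well defined, with value p, when this set is [set p] *)
Definition nearest (V : normedModType R) (S : set V) (x : V) : set V :=
  [set p | S p /\ forall q, S q -> `|x - p| <= `|x - q|].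

End notions.

Section problems.
Variables (R : realType) (d : nat) (Omega : lipschitz_domain R d).
Variables (U Y : completeNormedModType R).
Variables (iota A : {linear U -> L2 Omega}) (T : {linear L2 Omega -> Y}).
Variables (y : Y) (f0 : Linf Omega) (f1 : L2 Omega).
Local Notation mu := (lebOn Omega).

(* A u + f0 g = f1 in L^2(Omega) *)
Definition solves (u : U) (g : 'rV[R]_d -> R) :=
  \forall x \ae mu, A u x + f0 x * g x = f1 x.

Definition stateE (w : Linf Omega) (u : U) :=
  solves u (fun x => iota u x * w x).

Definition stateE_tau (Q : mesh Omega) (w : Linf Omega) (u : U) :=
  solves u (fun x => local_average Q (iota u) x * local_average Q w x).

Definition objective (u : U) : R := `|T (iota u) - y|.

Section identification.
Variable Wh : set (Linf Omega).

Definition feasible_I : set (U * Linf Omega) :=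
  [set uw | stateE uw.2 uw.1 /\ Wh uw.2].

Definition value_I : \bar R :=
  ereal_inf [set (objective uw.1)%:E | uw in feasible_I].

Definition argmin_I : set (U * Linf Omega) :=
  [set uw | feasible_I uw /\
    forall uw', feasible_I uw' -> objective uw.1 <= objective uw'.1].

End identification.

Section mccormick.
Variables (Q : mesh Omega) (Wh Zt : set (Linf Omega)).
Variables ul uu wl wu : 'I_(ncells Q) -> R.

Definition feasible_McC : set (U * Linf Omega * Linf Omega) :=
  [set uwz : U * Linf Omega * Linf Omega | let: (u, w, z) := uwz in
    [/\ solves u z, conv_hull Wh w, Zt z &
    exists2 c : 'I_(ncells Q) -> R, cell_values z c &
    forall i, \forall x \ae mu, cell i x ->
      let pu := local_average Q (iota u) x in
      let pw := local_average Q w x in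
      [/\ ul i * pw + wl i * pu - ul i * wl i - c i <= 0,
          uu i * pw + wu i * pu - uu i * wu i - c i <= 0,
          c i - uu i * pw - wl i * pu + uu i * wl i <= 0 &
          c i - ul i * pw - wu i * pu + ul i * wu i <= 0]]].

Definition value_McC : \bar R :=
  ereal_inf [set (objective uwz.1.1)%:E | uwz in feasible_McC].

End mccormick.

End problems.

(* Main.v *)
(** If (u, w) minimizes (I_delta) and utau solves (E_tau) for w, then
    (utau, w, (P utau)(P w)) satisfies the McCormick inequalities, so the relaxed
    value is at most |T utau - y| <= |T u - y| + |T u - T utau|. Without a
    minimizer the infimum is +oo and the right-hand side is -oo. *)

Require Import Defs.
From HB Require Import structures.
From mathcomp Require Import all_boot all_order all_algebra.
From mathcomp Require Import all_classical all_reals all_analysis.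
From mathcomp Require Import lra.
Set Implicit Arguments.
Unset Strict Implicit.
Unset Printing Implicit Defensive.
Import Order.TTheory GRing.Theory Num.Theory.
Import numFieldNormedType.Exports.
Local Open Scope classical_set_scope.
Local Open Scope ring_scope.

(** The four left-hand sides factor as [-(p - ul)(q - wl)], [-(uu - p)(wu - q)], [-(uu - p)(q - wl)]
    and [-(p - ul)(wu - q)], with all factors nonnegative. *)
Lemma mccormick_ineq (R : realDomainType) (ul uu wl wu p q : R) :
  ul <= p <= uu -> wl <= q <= wu ->
  [/\ ul * q + wl * p - ul * wl - p * q <= 0,
      uu * q + wu * p - uu * wu - p * q <= 0,
      p * q - uu * q - wl * p + uu * wl <= 0 &
      p * q - ul * q - wu * p + ul * wu <= 0].
Proof. by move=> /andP[? ?] /andP[? ?]; split; nra. Qed.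

(** Replacing the bilinear term of (E_tau) by [z] leaves the linear state equation of the
    relaxation, and the McCormick envelope contains the graph of the product over the box of
    bounds. *)
Lemma feasible_McC_state_tau (R : realType) (d : nat)
  (Omega : lipschitz_domain R d) (U : completeNormedModType R)
  (iota A : {linear U -> L2 Omega}) (f0 : Linf Omega) (f1 : L2 Omega)
  (Q : mesh Omega) (Wh Zt : set (Linf Omega))
  (ul uu wl wu : 'I_(ncells Q) -> R) (w z : Linf Omega) (u : U) :
  let P := local_average Q in
  Wh w -> stateE_tau iota A f0 f1 Q w u ->
  (forall i, \forall x \ae lebOn Omega,
     cell i x -> ul i <= P (iota u) x <= uu i) ->
  (forall i, \forall x \ae lebOn Omega, cell i x -> wl i <= P w x <= wu i) ->
  Zt z -> piecewise_constant Q z ->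
  (\forall x \ae lebOn Omega, z x = P (iota u) x * P w x) ->
  feasible_McC iota A f0 f1 Wh Zt ul uu wl wu (u, w, z).
Proof.
move=> P Whw Euw ubnd wbnd Ztz [c zc] zE; split=> //.
- apply: filterS2 Euw zE => x Eux zx; apply: etrans Eux.
  by congr (_ + _ * _); exact: zx.
(* The hull is the intersection of all convex sets [C] containing [Wh], and [w] lies in each of
   them. *)
- by move=> C [_]; apply.
exists c => // i.
apply: filterS2 (filterI (ubnd i) (wbnd i)) (filterI (zc i) zE).
move=> x [ux wx] [zx zxE] ix /=.
(* At almost every point of the cell, [z] takes both the value [c i] and the value of the
   product. *)
rewrite (_ : c i = P (iota u) x * P w x); last exact: etrans (esym (zx ix)) zxE.
by apply: mccormick_ineq; [exact: ux|exact: wx].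
Qed.

(** Attainment makes the optimal value a finite number, so it can be moved across inequalities in
    the extended reals. *)
Lemma value_I_argmin (R : realType) (d : nat)
  (Omega : lipschitz_domain R d) (U Y : completeNormedModType R)
  (iota A : {linear U -> L2 Omega}) (T : {linear L2 Omega -> Y}) (y : Y)
  (f0 : Linf Omega) (f1 : L2 Omega) (Wh : set (Linf Omega)) (u : U)
  (w : Linf Omega) :
  argmin_I iota A T y f0 f1 Wh (u, w) ->
  value_I iota A T y f0 f1 Wh = (objective iota T y u)%:E.
Proof.
move=> [uwF uwmin]; apply/eqP; rewrite eq_le; apply/andP; split.
  by apply: ereal_inf_lbound; exists (u, w).
by apply: le_ereal_inf_tmp => _ [uw' F' <-]; rewrite lee_fin; exact: uwmin.
Qed.

Theorem proposition4p2 (R : realType) (d : nat) (d_gt0 : (0 < d)%N)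
  (Omega : lipschitz_domain R d)
  (U Y : completeNormedModType R)
  (iota : {linear U -> L2 Omega}) (iotaP : continuous_embedding iota)
  (A : {linear U -> L2 Omega}) (AP : linear_isomorphism A)
  (T : {linear L2 Omega -> Y}) (TP : continuous T)
  (f0 : Linf Omega) (f0_ge0 : \forall x \ae lebOn Omega, 0 <= f0 x)
  (f1 : L2 Omega)
  (wl wu : Linf Omega)
  (Wad : set (Linf Omega)) (Wad_neq0 : Wad !=set0)
  (Wad_bounds : forall w, Wad w ->
     \forall x \ae lebOn Omega, wl x <= w x <= wu x)
  (delta : R) (delta_gt0 : 0 < delta) (ydata : R -> Y)
  (h : R -> R) (h_gt0 : 0 < h delta) (tau : R) (tau_gt0 : 0 < tau)
  (Qh : mesh Omega) (Qh_size : mesh_size Qh = h delta)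
  (Qtau : mesh Omega) (Qtau_size : mesh_size Qtau = tau)
  (V : mesh Omega -> set (L2 Omega)) :
  let Vh := V Qh in
  let Wh := Wad `&` (@LinfL2 R d Omega) @^-1` Vh in
  let P := local_average Qtau in
  let E := stateE iota A f0 f1 in
  let Etau := stateE_tau iota A f0 f1 Qtau in
  forall
  (A1 : [/\ closed Vh, convex_set Vh & within_fin_dim Vh])
  (A2 : forall w, Wad w ->
     (exists! u, E w u) /\ (exists! u, Etau w u))
  (A3 : exists ul uu : Linf Omega, forall w u, Wad w -> E w u ->
     \forall x \ae lebOn Omega, ul x <= iota u x <= uu x)
  (ulc uuc : 'I_(ncells Qtau) -> R)
  (A4 : forall w u, Wad w -> Etau w u -> forall i,
     \forall x \ae lebOn Omega, cell i x -> ulc i <= P (iota u) x <= uuc i)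
  (wlc wuc : 'I_(ncells Qtau) -> R)
  (A5 : forall w, Wh w -> forall i,
     \forall x \ae lebOn Omega, cell i x -> wlc i <= P w x <= wuc i)
  (A6 : forall w, Wad w -> exists p,
     nearest Vh (LinfL2 w) = [set p] /\
     nearest ((@LinfL2 R d Omega) @` Wh) (LinfL2 w) = [set p])
  (Zad : set (Linf Omega))
  (A7 : [/\ closed Zad, convex_set Zad, bounded_set Zad &
     forall w u, Wh w -> E w u -> mem_ae Zad (fun x => iota u x * w x)])
  (Ztau : set (Linf Omega))
  (A8 : [/\ closed Ztau, convex_set Ztau, bounded_set Ztau,
     forall z, Ztau z -> piecewise_constant Qtau z &
     forall w u, Wh w -> Etau w u ->
       mem_ae Ztau (fun x => P (iota u) x * P w x)]),
  (value_I iota A T (ydata delta) f0 f1 Wh >=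
   value_McC iota A T (ydata delta) f0 f1 Wh Ztau ulc uuc wlc wuc -
   ereal_inf [set s | exists u w utau,
     [/\ argmin_I iota A T (ydata delta) f0 f1 Wh (u, w), Etau w utau &
         s = (`|T (iota u) - T (iota utau)|)%:E]])%E.
Proof.
move=> /= _ _ _ ulc uuc A4 wlc wuc A5 _ _ _ Zt [_ _ _ Ztpc Ztuw].
set Wh := Wad `&` _; set y := ydata delta.
set mM := value_McC _ _ _ _ _ _ _ _ _ _ _ _; set S := [set s | _].
have [->|/set0P[s0 Ss0]] := eqVneq S set0.
  (* Adding [-oo] gives [-oo] by convention for every [mM], even [+oo]. *)
  by rewrite ereal_inf0 /= addeNy leNye.
have mM_le s : S s -> (mM - s <= value_I iota A T y f0 f1 Wh)%E.
  move=> [u [w [utau [uwmin Euw ->]]]]; rewrite (value_I_argmin uwmin).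
  have [[_ Whw] _] := uwmin.
  (* (A8) supplies a class in [Zt] that represents the product of the averages. *)
  have [z Ztz zE] := Ztuw w utau Whw Euw.
  have F := feasible_McC_state_tau Whw Euw (A4 _ _ Whw.1 Euw) (A5 _ Whw) Ztz
    (Ztpc _ Ztz) zE.
  rewrite leeBlDr//; apply: (@le_trans _ _ (objective iota T y utau)%:E).
    by apply: ereal_inf_lbound; exists (utau, w, z).
  by rewrite -EFinD lee_fin addrC distrC; exact: ler_distD.
(* The elements of [S] are norms, so the infimum lies between 0 and the finite element [s0]. *)
have S_fin : (ereal_inf S \is a fin_num)%E.
  rewrite ge0_fin_numE; last first.
    by apply: le_ereal_inf_tmp => _ [? [? [? [_ _ ->]]]]; rewrite lee_fin.
  apply: le_lt_trans (ereal_inf_lbound Ss0) _.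
  by have [? [? [? [_ _ ->]]]] := Ss0; rewrite ltry.
have [u [w [_ [uwmin _ _]]]] := Ss0.
(* Since [ereal_inf S] and the value of (I_delta) are finite, they can be exchanged: it remains to
   see that [mM] minus that value is a lower bound of [S], which is [mM_le] rearranged. *)
rewrite leeBlDr// -leeBlDl ?(value_I_argmin uwmin)//.
apply: le_ereal_inf_tmp => s Ss; have := mM_le _ Ss.
have [? [? [? [_ _ ->]]]] := Ss.
by rewrite (value_I_argmin uwmin) leeBlDr// leeBlDl.
Qed.
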